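(* Let $S$ be a finite set, $\mathcal{F}\subseteq 2^S$, $F\in\mathcal{F}$, and let $k$ be a positive integer. The inverse optimization problem $(S,\mathcal{F},F,\{w_i\}_{i=1}^k,\|\cdot\|_1)$ admits a mildly adequate optimal deviation vector $p$ for every choice of the weight functions $w_1,\dots,w_k\in\mathbb{R}^S$ if and only if for any $e\in S\setminus F$ there exists $f\in F$ such that $|F'\cap\{e,f\}|\le 1$ for every $F'\in\mathcal{F}$.
   Context: Notation: $[k]=\{1,\dots,k\}$; for $w\in\mathbb{R}^S$ and $X\subseteq S$, $w(X)=\sum_{s\in X}w(s)$; $\|p\|_1=\sum_{s\in S}|p(s)|$. An inverse optimization problem with multiple weight functions is a five-tuple $(S,\mathcal{F},F,\{w_i\}_{i=1}^k,\|\cdot\|_1)$, where $S$ is a finite ground set, $\mathcal{F}\subseteq 2^S$ is a collection of feasible solutions, $F\in\mathcal{F}$ is an input solution, and $w_1,\dots,w_k\in\mathbb{R}^S$ are weight functions. A vector $p\in\mathbb{R}^S$ is a feasible deviation vector if $F$ is a minimum weight member of $\mathcal{F}$ with respect to $w_i-p$ for all $i\in[k]$, that is, $(w_i-p)(F)\le (w_i-p)(F')$ for all $F'\in\mathcal{F}$ and $i\in[k]$. An optimal deviation vector is a feasible deviation vector minimizing $\|p\|_1$. A feasible deviation vector $p$ is adequate if $p(s)\ge 0$ for all $s\in F$ and $p(s)\le 0$ for all $s\in S\setminus F$. It is mildly adequate if it is adequate and $p(s)=0$ for all $s\in S\setminus F$.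
   Formalization: The case where S is nonempty and the empty set is the only feasible solution is excluded, since there p = 0 is always a mildly adequate optimal deviation vector although no f in F exists. *)

(* Defs.v *)
From HB Require Import structures.
From mathcomp Require Import all_boot all_order all_algebra.
From mathcomp Require Import reals.

Set Implicit Arguments.
Unset Strict Implicit.
Unset Printing Implicit Defensive.

Import Order.TTheory GRing.Theory Num.Theory.
Local Open Scope ring_scope.

Definition weight (R : realType) (S : finType) (w : {ffun S -> R})
    (X : {set S}) : R :=
  \sum_(s in X) w s.

Definition norm1 (R : realType) (S : finType) (p : {ffun S -> R}) : R :=
  \sum_(s : S) `|p s|.

Definition min_weight_member (R : realType) (S : finType)
    (FF : {set {set S}}) (v : {ffun S -> R}) (F : {set S}) : Prop :=
  F \in FF /\ forall F' : {set S}, F' \in FF -> weight v F <= weight v F'.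

(* In the definitions below, [(S, FF, F, w, norm1)] is the inverse optimization
   problem with [k] weight functions [w i], [i : 'I_k]. *)

Definition feasible_deviation (R : realType) (S : finType)
    (FF : {set {set S}}) (F : {set S}) (k : nat) (w : 'I_k -> {ffun S -> R})
    (p : {ffun S -> R}) : Prop :=
  forall i : 'I_k, min_weight_member FF (w i - p) F.

Definition optimal_deviation (R : realType) (S : finType)
    (FF : {set {set S}}) (F : {set S}) (k : nat) (w : 'I_k -> {ffun S -> R})
    (p : {ffun S -> R}) : Prop :=
  feasible_deviation FF F w p /\
  forall q : {ffun S -> R}, feasible_deviation FF F w q -> norm1 p <= norm1 q.

Definition adequate (R : realType) (S : finType)
    (FF : {set {set S}}) (F : {set S}) (k : nat) (w : 'I_k -> {ffun S -> R})
    (p : {ffun S -> R}) : Prop :=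
  [/\ feasible_deviation FF F w p,
      forall s, s \in F -> 0 <= p s
    & forall s, s \notin F -> p s <= 0].

Definition mildly_adequate (R : realType) (S : finType)
    (FF : {set {set S}}) (F : {set S}) (k : nat) (w : 'I_k -> {ffun S -> R})
    (p : {ffun S -> R}) : Prop :=
  adequate FF F w p /\ forall s, s \notin F -> p s = 0.

(* Here [F = set0] is forced, every deviation vector is feasible, and [p = 0] is
   optimal and mildly adequate for all weights, although no [f \in F] exists for
   any [e] outside [F]. The characterization of mildly adequate optima by the
   condition on pairs [e], [f] therefore excludes this case. *)
Definition degenerate_collection (S : finType) (FF : {set {set S}}) : Prop :=
  FF = [set set0] /\ (0 < #|S|)%N.

(* Main.v *)
Require Import Defs.
From mathcomp Require Import all_boot all_order all_algebra.
From mathcomp Require Import reals.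
From mathcomp Require Import boolp classical_sets topology normedtype derive.
From mathcomp Require Import lra.

(** Feasibility of p amounts to the linear inequalities
    w_i(F) - w_i(F') <= p(F) - p(F'), so an optimal deviation vector always
    exists: the inequalities have a solution, they cut out a closed set, and
    only the solutions in a bounded box compete with a given one
    ([optimal_deviation_exists]).

    Suppose each e outside F has a partner phi(e) in F that never occurs
    together with e in a feasible solution, and put phi(f) = f on F. Transport
    the mass |q(s)| of an optimal q from s to phi(s). The l1-norm does not
    change, and the new vector is nonnegative and vanishes outside F. It remains
    feasible: for e in F' outside F, the mass |q(e)| used to increase
    p(F) - p(F') by at most |q(e)|, and it now sits on an element of F outside
    F', where it increases the difference by exactly |q(e)|
    ([pushforward_abs_mildly_adequate]). Hence it is a mildly adequate optimum.

    Conversely, let e lie outside F and in some feasible solution, and let every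
    w_i be minus the indicator of e. This vector is itself feasible, of norm 1,
    so an optimal p has norm at most 1. When p is mildly adequate,
    p(F) - p(F') >= 1 for every F' containing e, which forces p(F) = 1 and
    p = 0 on F'. If each f in F shared some F' with e, then p would vanish on all
    of F, contradicting p(F) = 1; so e has a partner
    ([exists_avoiding_partner]). If e lies in no feasible solution, every element
    of F is a partner, and the only danger is an empty F. Nondegeneracy then
    provides another element e' that lies in some feasible solution, and the
    previous argument applied to e' produces an element of F. *)

Set Implicit Arguments.
Unset Strict Implicit.
Unset Printing Implicit Defensive.

Import Order.TTheory GRing.Theory Num.Theory.
Import numFieldNormedType.Exports.
Local Open Scope ring_scope.

(** * Feasibility as a system of linear inequalities *)

Lemma weightB (R : realType) (S : finType) (w p : {ffun S -> R}) (X : {set S}) :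
  weight (w - p) X = weight w X - weight p X.
Proof. by rewrite /weight -sumrB; apply: eq_bigr => s _; rewrite !ffunE. Qed.

Lemma weight_indicator (R : realType) (S : finType) (w : {ffun S -> R})
    (X : {set S}) :
  weight w X = \sum_s w s *+ (s \in X).
Proof. by rewrite /weight big_mkcond; apply: eq_bigr => s _; case: ifP. Qed.

Lemma feasible_deviationP (R : realType) (S : finType) (FF : {set {set S}})
    (F : {set S}) (k : nat) (w : 'I_k -> {ffun S -> R}) (p : {ffun S -> R}) :
  F \in FF ->
  feasible_deviation FF F w p <->
  forall i F', F' \in FF ->
    weight (w i) F - weight (w i) F' <= weight p F - weight p F'.
Proof.
move=> hF; split=> [hp i F' hF'|hp i].
  by have [_ /(_ _ hF')] := hp i; rewrite !weightB; lra.
by split=> // F' hF'; have := hp i F' hF'; rewrite !weightB; lra.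
Qed.

(** A large constant M on F and -M off F works: p(F) - p(F') is M times the size
    of the symmetric difference of F and F', hence at least M when F' differs
    from F. *)
Lemma feasible_deviation_exists (R : realType) (S : finType)
    (FF : {set {set S}}) (F : {set S}) (k : nat) (w : 'I_k -> {ffun S -> R}) :
  F \in FF -> exists p, feasible_deviation FF F w p.
Proof.
move=> hF.
pose M := \sum_i \sum_(F' in FF) `|weight (w i) F - weight (w i) F'|.
have M0 : 0 <= M by apply: sumr_ge0 => i _; apply: sumr_ge0.
exists [ffun s => if s \in F then M else - M].
apply/(feasible_deviationP _ _ hF) => i F' hF'.
have [<-|neqFF'] := eqVneq F F'; first by rewrite !subrr.
have leM : weight (w i) F - weight (w i) F' <= M.
  apply: le_trans (ler_norm _) _.
  rewrite /M (bigD1 i) //= (bigD1 F') //= -addrA lerDl.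
  by apply: addr_ge0; apply: sumr_ge0 => // j _; apply: sumr_ge0.
apply: (le_trans leM); rewrite !weight_indicator -sumrB.
have [s sFF'] : exists s, (s \in F) != (s \in F').
  apply/existsP; apply: contraNT neqFF' => /existsPn eqFF'.
  by apply/eqP/setP => s; apply/eqP; have := eqFF' s; rewrite negbK.
rewrite (bigD1 s) //= ler_wpDr //.
  apply: sumr_ge0 => t _; rewrite ffunE.
  by case: (t \in F); case: (t \in F'); rewrite ?mulr0n ?mulr1n; lra.
rewrite ffunE; move: sFF'.
by case: (s \in F); case: (s \in F'); rewrite ?mulr0n ?mulr1n //=; lra.
Qed.

(** * Existence of optimal deviation vectors *)

Lemma ler_norm1 (R : realType) (S : finType) (p : {ffun S -> R}) (s : S) :
  `|p s| <= norm1 p.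
Proof. by rewrite /norm1 (bigD1 s) //= lerDl sumr_ge0. Qed.

(** Extreme value theorem on the feasible vectors whose coordinates are bounded
    by the norm of one feasible p0; any feasible vector that leaves this box
    has norm larger than p0. Compactness of the box is Tychonoff's theorem for
    the topology of pointwise convergence on the functions from S to R. *)
Lemma optimal_deviation_exists (R : realType) (S : finType)
    (FF : {set {set S}}) (F : {set S}) (k : nat) (w : 'I_k -> {ffun S -> R}) :
  F \in FF -> exists p, optimal_deviation FF F w p.
Proof.
move=> hF; have [p0 hp0] := feasible_deviation_exists w hF.
pose box := [set g : {ptws S -> R} |
  forall s, `[- norm1 p0, norm1 p0]%classic (g s)]%classic.
pose ffun_of (g : {ptws S -> R}) : {ffun S -> R} := [ffun s => g s].
pose feas := [set g | feasible_deviation FF F w (ffun_of g)]%classic.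
have coordC (s : S) : continuous (fun g : {ptws S -> R} => g s).
  exact: (@proj_continuous S (fun=> R) s).
have weightC (X : {set S}) : continuous (fun g => weight (ffun_of g) X).
  have -> : (fun g => weight (ffun_of g) X) = (fun g => \sum_(s in X) g s).
    by apply/funext => g; apply: eq_bigr => s _; rewrite ffunE.
  by apply: continuous_big => //; exact: add_continuous.
have norm1C : continuous (fun g => norm1 (ffun_of g)).
  have -> : (fun g => norm1 (ffun_of g)) = (fun g => \sum_s `|g s|).
    by apply/funext => g; apply: eq_bigr => s _; rewrite ffunE.
  apply: continuous_big; first exact: add_continuous.
  by move=> s _ g; exact: (cvg_norm (coordC s g)).
have feas_closed : closed feas.
  have -> : feas = (\bigcap_i \bigcap_(F' in [set F' | F' \in FF])
     (fun g => weight (ffun_of g) F - weight (ffun_of g) F') @^-1`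
       [set x | weight (w i) F - weight (w i) F' <= x])%classic.
    apply/seteqP; split => g /=.
      by move=> /(feasible_deviationP _ _ hF) hg i _ F' hF'; exact: hg.
    by move=> hg; apply/(feasible_deviationP _ _ hF) => i F' hF'; exact: hg.
  apply: closed_bigI => i _; apply: closed_bigI => F' _.
  apply: closed_comp; last exact: closed_ge.
  by move=> g _; exact: (cvgB (weightC F g) (weightC F' g)).
have K_compact : compact (box `&` feas)%classic.
  apply: compact_closedI => //.
  exact: (@tychonoff S (fun=> R) (fun=> `[- norm1 p0, norm1 p0]%classic)
    (fun=> @segment_compact _ _ _)).
have in_box q : norm1 q <= norm1 p0 -> box q.
  by move=> hq s; rewrite /= in_itv /= -ler_norml (le_trans (ler_norm1 q s)).
have ffunK (q : {ffun S -> R}) : ffun_of q = q.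
  by apply/ffunP => s; rewrite ffunE.
have K_nonempty : (box `&` feas !=set0)%classic.
  by exists p0; split; [exact: in_box | rewrite /feas/= ffunK].
have [g /set_mem[_ hg] gmin] :=
  compact_EVT_min K_nonempty K_compact (continuous_subspaceT norm1C).
exists (ffun_of g); split=> // q hq.
have [le_q|/ltW le_q] := leP (norm1 q) (norm1 p0).
  rewrite -[q in leRHS]ffunK; apply: gmin; apply/mem_set; split.
    exact: in_box.
  by rewrite /feas/= ffunK.
apply: le_trans le_q; rewrite -[p0]ffunK; apply: gmin; apply/mem_set; split.
  exact: in_box.
by rewrite /feas/= ffunK.
Qed.

(** * Transporting a deviation vector onto F *)

(** The image under phi of the measure on S with density |q|. *)
Definition pushforward_abs (R : realType) (S : finType) (phi : S -> S)
    (q : {ffun S -> R}) : {ffun S -> R} :=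
  [ffun f => \sum_(s | phi s == f) `|q s|].

Lemma pushforward_abs_ge0 (R : realType) (S : finType) (phi : S -> S)
    (q : {ffun S -> R}) (f : S) :
  0 <= pushforward_abs phi q f.
Proof. by rewrite ffunE sumr_ge0. Qed.

Lemma weight_pushforward_abs (R : realType) (S : finType) (phi : S -> S)
    (q : {ffun S -> R}) (X : {set S}) :
  weight (pushforward_abs phi q) X = \sum_s `|q s| *+ (phi s \in X).
Proof.
transitivity (\sum_(s | phi s \in X) `|q s|); last first.
  by rewrite big_mkcond; apply: eq_bigr => s _; case: ifP.
rewrite (partition_big phi (mem X)) //=; apply: eq_bigr => f fX.
rewrite ffunE; apply: eq_bigl => s.
by case: eqP => [->|]; rewrite ?andbF // fX.
Qed.

Lemma norm1_pushforward_abs (R : realType) (S : finType) (phi : S -> S)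
    (q : {ffun S -> R}) :
  norm1 (pushforward_abs phi q) = norm1 q.
Proof.
transitivity (weight (pushforward_abs phi q) [set: S]).
  rewrite /weight big_mkcond; apply: eq_bigr => s _.
  by rewrite inE ger0_norm ?pushforward_abs_ge0.
by rewrite weight_pushforward_abs; apply: eq_bigr => s _; rewrite inE.
Qed.

(** The feasibility inequality for q is improved term by term: the contribution
    of s to p(F) - p(F') is |q s| * (1 - [phi s in F']) in the image
    and q s * ([s in F] - [s in F']) in q. On F the two brackets agree because
    phi s = s. Off F the second bracket is -1 or 0, and when it is -1, that is,
    for s in F', the partner property makes the first bracket equal to 1. *)
Lemma pushforward_abs_mildly_adequate (R : realType) (S : finType)
    (FF : {set {set S}}) (F : {set S}) (k : nat) (w : 'I_k -> {ffun S -> R})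
    (phi : S -> S) (q : {ffun S -> R}) :
  F \in FF ->
  (forall s, phi s \in F) ->
  {in F, forall s, phi s = s} ->
  (forall e F', e \notin F -> F' \in FF -> e \in F' -> phi e \notin F') ->
  feasible_deviation FF F w q ->
  mildly_adequate FF F w (pushforward_abs phi q).
Proof.
move=> hF phiF phi_id phi_avoid hq.
have p0 s : s \notin F -> pushforward_abs phi q s = 0.
  move=> sF; rewrite ffunE big_pred0 // => t.
  by apply/negbTE; apply: contraNneq sF => <-.
split=> //; split=> [|s _|s /p0 -> //]; last exact: pushforward_abs_ge0.
apply/(feasible_deviationP _ _ hF) => i F' hF'.
have /(feasible_deviationP _ _ hF)/(_ i F' hF') := hq.
move=> /le_trans; apply.
rewrite !weight_pushforward_abs !weight_indicator -!sumrB.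
apply: ler_sum => s _; rewrite phiF.
have := ler_norm (q s); have := ler_norm (- q s); rewrite normrN.
have [sF|sF] := boolP (s \in F).
  by rewrite (phi_id _ sF); case: (s \in F'); rewrite ?mulr0n ?mulr1n; lra.
have [sF'|sF'] := boolP (s \in F').
  by rewrite (negbTE (phi_avoid _ _ sF hF' sF')) !mulr0n !mulr1n; lra.
by case: (phi s \in F'); rewrite ?mulr0n ?mulr1n; lra.
Qed.

(** * A weight function concentrated on one element *)

Definition spike (R : realType) (S : finType) (e : S) : {ffun S -> R} :=
  [ffun s => - (s == e)%:R].

Lemma weight_spike (R : realType) (S : finType) (e : S) (X : {set S}) :
  weight (spike R e) X = - (e \in X)%:R.
Proof.
rewrite weight_indicator (bigD1 e) //= big1 ?addr0 => [|s /negbTE se].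
  by rewrite ffunE eqxx; case: (e \in X); rewrite ?mulr1n ?mulr0n ?oppr0.
by rewrite ffunE se oppr0 mul0rn.
Qed.

Lemma norm1_spike (R : realType) (S : finType) (e : S) :
  norm1 (spike R e) = 1.
Proof.
rewrite /norm1 (bigD1 e) //= big1 ?addr0 => [|s /negbTE se].
  by rewrite ffunE eqxx normrN1.
by rewrite ffunE se oppr0 normr0.
Qed.

Lemma spike_feasible (R : realType) (S : finType) (FF : {set {set S}})
    (F : {set S}) (k : nat) (e : S) :
  F \in FF -> feasible_deviation FF F (fun _ : 'I_k => spike R e) (spike R e).
Proof. by move=> hF; apply/(feasible_deviationP _ _ hF). Qed.

(** The spike itself is feasible of norm 1, which bounds p(F) above by 1, while
    feasibility of p against F' gives p(F) >= 1 + p(F'). As p is nonnegative,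
    both bounds are tight and no mass is left on F'. *)
Lemma spike_mildly_adequate_optimal (R : realType) (S : finType)
    (FF : {set {set S}}) (F : {set S}) (k : nat) (e : S) (p : {ffun S -> R}) :
  F \in FF -> (0 < k)%N -> e \notin F ->
  optimal_deviation FF F (fun _ : 'I_k => spike R e) p ->
  mildly_adequate FF F (fun _ : 'I_k => spike R e) p ->
  forall F', F' \in FF -> e \in F' ->
    weight p F = 1 /\ {in F', forall f, p f = 0}.
Proof.
move=> hF hk eF [_ pmin] [[hp pF _] p0] F' hF' eF'.
have p_ge0 s : 0 <= p s by have [/pF//|/p0 ->] := boolP (s \in F).
have le1 : weight p F <= 1.
  have := pmin _ (@spike_feasible _ _ _ _ k e hF).
  rewrite norm1_spike; apply: le_trans.
  rewrite weight_indicator; apply: ler_sum => s _.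
  by rewrite ger0_norm //; case: (s \in F); rewrite ?mulr0n ?mulr1n.
have /(feasible_deviationP _ _ hF)/(_ (Ordinal hk) F' hF') := hp.
rewrite !weight_spike eF' (negbTE eF) /= => ge1.
have pF'_ge0 : 0 <= weight p F' by apply: sumr_ge0.
split=> [|f fF']; first by lra.
have : p f <= weight p F' by rewrite /weight (bigD1 f) //= lerDl sumr_ge0.
by have := p_ge0 f; lra.
Qed.

(** * The characterization *)

Lemma card_setI_pair_le1 (S : finType) (e f : S) (A : {set S}) :
  e != f -> (#|A :&: [set e; f]| <= 1)%N = ~~ ((e \in A) && (f \in A)).
Proof.
move=> ef; rewrite leqNgt; congr (~~ _); apply/card_gt1P/andP.
  move=> [x [y [/setIP[xA xef] /setIP[yA yef] xy]]].
  move: xef yef xy; rewrite !inE.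
  by move=> /pred2P[] ? /pred2P[] ?; subst x y; rewrite ?eqxx.
by move=> [eA fA]; exists e, f; rewrite !inE eA fA !eqxx orbT.
Qed.

(** If no f in F avoided e, the solutions containing e would together
    cover F, and the mildly adequate optimum for the spike at e would vanish on F
    although it has weight 1 there. Without a solution F' containing e this
    weight could be 0, and F could be empty. *)
Lemma exists_avoiding_partner (R : realType) (S : finType) (FF : {set {set S}})
    (F : {set S}) (k : nat) :
  F \in FF -> (0 < k)%N ->
  (forall w : 'I_k -> {ffun S -> R},
     exists p, optimal_deviation FF F w p /\ mildly_adequate FF F w p) ->
  forall e F', e \notin F -> F' \in FF -> e \in F' ->
  exists f, f \in F /\ forall F'', F'' \in FF -> e \in F'' -> f \notin F''.
Proof.
move=> hF hk mild e F' eF hF' eF'.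
have [p [popt pmild]] := mild (fun=> spike R e).
have p_spike := spike_mildly_adequate_optimal hF hk eF popt pmild.
have [pF1 _] := p_spike _ hF' eF'.
apply: contrapT => no_partner.
have : weight p F = 0.
  rewrite /weight big1 // => f fF; apply: contrapT => pf0.
  apply: no_partner; exists f; split=> // F'' hF'' eF''.
  by apply: contra_notN pf0; have [_] := p_spike _ hF'' eF''; apply.
by rewrite pF1; apply/eqP; exact: oner_neq0.
Qed.

Theorem theorem5 (R : realType) (S : finType) (FF : {set {set S}})
    (F : {set S}) (k : nat)
    (hF : F \in FF) (hk : (0 < k)%N)
    (hFF : ~ degenerate_collection FF) :
  (forall w : 'I_k -> {ffun S -> R},
     exists p : {ffun S -> R},
       optimal_deviation FF F w p /\ mildly_adequate FF F w p)
  <->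
  (forall e : S, e \in ~: F ->
     exists f : S, f \in F /\
       forall F' : {set S}, F' \in FF -> (#|F' :&: [set e; f]| <= 1)%N).
Proof.
split=> [mild e|partner w].
  rewrite inE => eF.
  have avoiding := exists_avoiding_partner hF hk mild.
  have to_card f : f \in F ->
      (forall F', F' \in FF -> e \in F' -> f \notin F') ->
      exists f0, f0 \in F /\
        forall F', F' \in FF -> (#|F' :&: [set e; f0]| <= 1)%N.
    move=> fF f_avoids; exists f; split=> // F' hF'.
    rewrite card_setI_pair_le1; last by apply: contraNneq eF => ->.
    by apply/negP => /andP[eF' fF']; move: (f_avoids _ hF' eF'); rewrite fF'.
  have [/existsP[F' /andP[hF' eF']]|e_unused] :=
      boolP [exists F' in FF, e \in F'].
    by have [f [fF f_avoids]] := avoiding _ _ eF hF' eF'; exact: to_card fF _.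
  (* No solution contains e: any element of F will do, provided there is one. *)
  have [F0|[f fF]] := set_0Vmem F; last first.
    apply: (to_card f fF) => F' hF' eF'.
    by case/negP: e_unused; apply/existsP; exists F'; rewrite hF'.
  (* F is empty; a nonempty solution would produce an element of F, so set0 is
     the only one. *)
  case: hFF; split; last by apply/card_gt0P; exists e.
  apply/setP => F'; rewrite inE.
  have [->|[e' e'F']] := set_0Vmem F'; first by rewrite eqxx -F0.
  have /negbTE -> : F' != finset.set0 by apply/set0Pn; exists e'.
  apply/negbTE/negP => hF'.
  have e'F : e' \notin F by rewrite F0 inE.
  by have [f [+ _]] := avoiding _ _ e'F hF' e'F'; rewrite F0 inE.
have /choice[phi phiP] s : exists f, [/\ f \in F, s \in F -> f = s
    & s \notin F -> forall F', F' \in FF -> s \in F' -> f \notin F'].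
  have [sF|sF] := boolP (s \in F); first by exists s.
  have [|f [fF pairP]] := partner s; first by rewrite inE.
  exists f; split=> // _ F' hF' sF'.
  have sf : s != f by apply: contraNneq sF => ->.
  by have := pairP _ hF'; rewrite card_setI_pair_le1 // sF'.
have [q [qfeas qmin]] := optimal_deviation_exists w hF.
have pmild : mildly_adequate FF F w (pushforward_abs phi q).
  apply: pushforward_abs_mildly_adequate => // [s|s sF|e F' eF].
  - by have [] := phiP s.
  - by have [_ /(_ sF)] := phiP s.
  - by have [_ _ /(_ eF)] := phiP e; apply.
exists (pushforward_abs phi q); split=> //; split; first by case: pmild => -[].
by move=> r /qmin; rewrite norm1_pushforward_abs.
Qed.
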